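(* The boolean number $\beta(\lambda)$ of the Ferrers graph associated to the shape $\lambda=(\lambda_1,\ldots,\lambda_r)$ can be computed recursively according to the formula $$\beta(\lambda)=\begin{cases}1 & \text{if } r=1;\\[4pt] \lambda_r\cdot\beta(\underline{\lambda})+\displaystyle\sum_{\ell=1}^{\lambda_r}\binom{\lambda_r+1}{\ell+1}\cdot\beta(\underline{\lambda}[-\ell]) & \text{if } r>1.\end{cases}$$
   Context: Boolean number: for a finite simple graph $G$, the boolean complex of $G$ is the regular cell complex associated to the simplicial poset whose elements are equivalence classes of strings of distinct vertices of $G$, two strings being equivalent if one can be transformed into the other by commuting letters that are non-adjacent in $G$, with partial order induced by substring inclusion. It is known that this complex is homotopy equivalent to a wedge of $\beta(G)$ spheres of dimension $|G|-1$, where $|G|$ is the number of vertices of $G$; the integer $\beta(G)$ is called the boolean number of $G$. It can be computed recursively by $\beta(\emptyset)=1$ for the empty graph, $\beta(\delta_n)=0$ where $\delta_n$ ($n\ge1$) is the graph of $n$ isolated vertices, and, for any edge $e$ of $G$, $\beta(G)=\beta(G-e)+\beta(G/e)+\beta(G-[e])$. Here $G-e$ is obtained by deleting the edge $e$; $G/e$ is obtained by contracting $e$ and then removing all loops and redundant (parallel) edges; $G-[e]$ is obtained by removing $e$ together with its two end vertices. Ferrers shapes and graphs: a Ferrers shape with $r$ rows is a sequence $\lambda=(\lambda_1,\ldots,\lambda_r)$ of integers with $\lambda_1\ge\cdots\ge\lambda_r\ge0$ (the number of rows is prescribed, and rows may be empty). Its Ferrers graph has vertex set $\{x_1,\ldots,x_r\}\sqcup\{y_1,\ldots,y_{\lambda_1}\}$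 and an edge $\{x_i,y_j\}$ if and only if $\lambda_i\ge j$. Write $\beta(\lambda)$ for the boolean number of this graph. For a shape $\lambda$ with $r>1$ rows, $\underline{\lambda}=(\lambda_1,\ldots,\lambda_{r-1})$ is the shape obtained by deleting the bottom row. For a shape $\mu=(\mu_1,\ldots,\mu_s)$ and an integer $t\ge-\mu_s$, $\mu[t]=(\mu_1+t,\ldots,\mu_s+t)$ (still with $s$ rows).
   Formalization: For r=1 the value is 1 only when λ_1≥1; for the shape λ=(0), whose graph is a single isolated vertex, the boolean number is 0 (not 1), and the formal statement gives 0 there. *)

(* Defs.v *)
From mathcomp Require Import all_boot all_order all_algebra.

Set Implicit Arguments.
Unset Strict Implicit.
Unset Printing Implicit Defensive.

Import GRing.Theory.

Record sgraph := SGraph {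
  vertex :> finType;
  edge : rel vertex;
  edge_sym : symmetric edge;
  edge_irr : irreflexive edge
}.

(** * The boolean complex *)

(* The bound #|G| on the length is automatic for strings of distinct vertices;
   it only serves to make the type finite. *)
Definition bstring (G : sgraph) : finType := {w : #|G|.-bseq G | uniq w}.

Definition letters_of (G : sgraph) (w : bstring G) : seq G := val (val w).

Definition swap_step (G : sgraph) (u v : bstring G) : bool :=
  [exists i : 'I_#|G|, exists a : G, exists b : G,
    let p := take i (letters_of u) in
    let q := drop i.+2 (letters_of u) in
    [&& letters_of u == p ++ [:: a; b] ++ q,
        letters_of v == p ++ [:: b; a] ++ q
      & ~~ edge a b]].

(* The simplicial poset: commutation classes, including the class of the empty
   string, which is its bottom element (the empty cell, of dimension -1). *)
Definition boolean_poset (G : sgraph) : {set {set bstring G}} :=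
  equivalence_partition (connect (@swap_step G)) [set: bstring G].

(* "Substring" means subword (letters need not be consecutive): this is what
   makes every lower interval a boolean lattice. *)
Definition face_le (G : sgraph) (c d : {set bstring G}) : bool :=
  [exists u in c, exists v in d, subseq (letters_of u) (letters_of v)].

(* The vertices of the simplex c; a cell with k letters has dimension k - 1. *)
Definition letters (G : sgraph) (c : {set bstring G}) : {set G} :=
  [set v | [exists w in c, v \in letters_of w]].

Definition cells (G : sgraph) (k : nat) : {set {set bstring G}} :=
  [set c in boolean_poset G | #|letters c| == k].

(** * Its reduced cellular homology *)

Local Open Scope ring_scope.

(* Every simplex is oriented by the order in which its vertices appear in the
   enumeration of the vertices of G. When d is a facet of c, the set
   [letters c :\: letters d] is a singleton {v}, and the incidence number is
   (-1) to the number of vertices of c preceding v. *)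
Definition incidence (G : sgraph) (c d : {set bstring G}) : rat :=
  if face_le d c && (#|letters c| == #|letters d|.+1)
  then \prod_(v in letters c :\: letters d)
         (-1) ^+ #|[set u in letters c | (enum_rank u < enum_rank v)%N]|
  else 0.

(* The boundary map on chains of dimension k - 1, acting on row vectors. It is
   0 for k = 0, and the augmentation for k = 1. *)
Definition boundary (G : sgraph) (k : nat) :
    'M[rat]_(#|cells G k|, #|cells G k.-1|) :=
  \matrix_(i, j) incidence (enum_val i) (enum_val j).

(* The rank of the reduced homology group in dimension k - 1. *)
Definition reduced_betti (G : sgraph) (k : nat) : nat :=
  (\rank (kermx (boundary G k)) - \rank (boundary G k.+1))%N.

Local Close Scope ring_scope.

(* As the boolean complex is a wedge of spheres of dimension #|G| - 1 up to
   homotopy, the number of spheres is the rank of its reduced homology in that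
   dimension. For the empty graph the complex is the (-1)-sphere, and the
   number is 1. *)
Definition boolean_number (G : sgraph) : nat := reduced_betti G #|G|.

(** * Ferrers shapes and graphs *)

Definition ferrers_shape (la : seq nat) : bool :=
  (0 < size la) && sorted geq la.

(* Rows and columns are numbered from 0. *)
Definition ferrers_edge (la : seq nat)
    (u v : 'I_(size la) + 'I_(head 0 la)) : bool :=
  match u, v with
  | inl i, inr j | inr j, inl i => j < nth 0 la i
  | _, _ => false
  end.

Fact ferrers_edge_sym (la : seq nat) : symmetric (@ferrers_edge la).
Proof. by case=> [i|j] [i'|j']. Qed.

Fact ferrers_edge_irr (la : seq nat) : irreflexive (@ferrers_edge la).
Proof. by case. Qed.

Definition ferrers_graph (la : seq nat) : sgraph :=
  SGraph (@ferrers_edge_sym la) (@ferrers_edge_irr la).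

Definition beta (la : seq nat) : nat := boolean_number (ferrers_graph la).

Definition last_row (la : seq nat) : nat := last 0 la.

Definition delete_last_row (la : seq nat) : seq nat := take (size la).-1 la.

(* The shape mu[-l]; used only when l is at most the last row of mu, so that
   the subtractions are exact. *)
Definition shift_down (mu : seq nat) (l : nat) : seq nat :=
  [seq m - l | m <- mu].

(* Main.v *)
Require Import Defs.
From mathcomp Require Import all_boot all_order all_algebra.
From mathcomp Require Import zify.

(** A cell of the boolean complex is a set [S] of vertices together with an
acyclic orientation of the graph induced on [S]: commuting non-adjacent letters
forgets everything about a word except its letters and the relative order of
adjacent letters ([codeP]), and passing to a face restricts the orientation
([face_leE]). As the sign of a facet of a top cell depends only on the missing
vertex, a top-dimensional cycle is a function on the acyclic orientations of [G]
whose push-forward under the deletion of any vertex is zero.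

Deletion of [v] has a right inverse, which puts [v] before all its neighbours,
and this inverse commutes with the deletion of every other vertex. Imposing the
vanishing conditions one vertex at a time therefore lowers the dimension by
exactly the dimension of the same space for [G - v] ([rank_cycles_insert]). With
[a(S)] the number of acyclic orientations of the graph induced on [S], this gives
[boolean_numberE]: beta(G) is the sum of [(-1)^|V - S| a(S)] over all sets [S] of
vertices. Write [b(U)] for the same sum over the subsets [S] of [U]; it is the
boolean number of the graph induced on [U].

Let now [x] be a vertex all of whose neighbours have the same neighbourhood. In
an acyclic orientation these neighbours are arranged in levels, [y] being below
[y'] when there is a path [y -> z -> y']. The neighbours that precede [x] are
either none, or all those below some level together with a nonempty part [L] of
that level. In the second case the elements of [L] can be merged into one of
them, [l], and [x] forgotten, without loss of information; this yields
[num_acyclic_insert]: [a(x + S)] is [a(S)] plus the sum of [a(S - L + l)] over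
the nonempty sets [L] of neighbours of [x] in [S]. Alternating sums turn this
into [alternating_insert_twins]: [b(x + U)] is the sum over [L] of
[b(U - L) + b(U - L + l)].

The vertex of the last row of a Ferrers graph is of this kind, its neighbours
being the columns of full height. Removing that row and [k] such columns leaves
the Ferrers graph of the shifted shape [mu[-k]], where [mu] is the shape without
its last row ([remove_columns]). Grouping the sets [L] by size, with [m] the
length of the last row, beta(la) is the sum over [1 <= k <= m] of
[C(m, k) (beta(mu[-k]) + beta(mu[-(k-1)]))], and Pascal's rule concludes
([binomial_shift]). For a single row, what remains after removing [x] has no
edge, so that only the set [L] of all columns contributes. *)

Set Implicit Arguments.
Unset Strict Implicit.
Unset Printing Implicit Defensive.

Import GRing.Theory.

(** * Acyclic orientations and commutation classes of words *)

Section SortedByHeight.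

Variables (T : eqType) (h : T -> nat).

Lemma index_sorted (s : seq T) (a b : T) :
  sorted (relpre h leq) s -> a \in s -> b \in s -> h a != h b ->
  (index a s < index b s) = (h a < h b).
Proof.
move=> ss sa sb hab.
have tr : transitive (relpre h leq) by move=> y x z /=; apply: leq_trans.
have le x y : x \in s -> y \in s -> index x s < index y s -> h x <= h y.
  by move=> sx sy; apply: (sorted_ltn_index tr ss).
case: (ltngtP (index a s) (index b s)) => [lt_ab|lt_ba|eq_ab].
- by rewrite ltn_neqAle hab le.
- by apply/esym/negbTE; rewrite -leqNgt le.
- by move: hab; rewrite -(nth_index a sa) eq_ab (nth_index a sb) eqxx.
Qed.

End SortedByHeight.

Lemma sorted_index (T : eqType) (s : seq T) :
  uniq s -> sorted (relpre (index^~ s) leq) s.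
Proof.
move=> us; rewrite -sorted_map.
suff -> : map (index^~ s) s = iota 0 (size s) by apply: iota_sorted.
case: s us => // x s us.
apply: (@eq_from_nth _ 0) => [|i]; rewrite size_map ?size_iota // => lt_i.
by rewrite (nth_map x) // nth_iota // index_uniq.
Qed.

Lemma index_subseq (T : eqType) (s t : seq T) (a b : T) :
  uniq t -> subseq s t -> a \in s -> b \in s -> 
  (index a s < index b s) = (index a t < index b t).
Proof.
move=> ut st sa sb; case: (eqVneq a b) => [->|nab]; first by rewrite !ltnn.
apply: (@index_sorted _ (index^~ t)) => //.
  apply: (subseq_sorted _ st (sorted_index ut)) => y x z /=; apply: leq_trans.
have ta := mem_subseq st sa; have tb := mem_subseq st sb.
apply: contraNneq nab => eq_ab.
by rewrite -(nth_index a ta) eq_ab (nth_index a tb).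
Qed.

Section Orientations.

Variable G : sgraph.
Implicit Types (S : {set G}) (h : G -> nat) (o : {set G * G}).

(** The orientation, from lower to higher, that a height function induces on
the graph spanned by [S]. All acyclic orientations arise in this way; heights
are far easier to modify than words or arc sets. *)
Definition orient h S : {set G * G} :=
  [set p | [&& p.1 \in S, p.2 \in S, edge p.1 p.2 & h p.1 < h p.2]].

Definition restrict S o : {set G * G} := [set p in o | (p.1 \in S) && (p.2 \in S)].

(** Adjacent vertices at equal height would leave their edge unoriented. *)
Definition proper_height h S : Prop :=
  {in S &, forall a b, edge a b -> h a <> h b}.

Definition letter_set (w : bstring G) : {set G} := [set x in letters_of w].

Definition arcs (w : bstring G) : {set G * G} :=
  orient (index^~ (letters_of w)) (letter_set w).

Definition acyclic S : {set {set G * G}} :=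
  [set arcs w | w : bstring G & letter_set w == S].

Lemma letters_uniq (w : bstring G) : uniq (letters_of w).
Proof. exact: valP w. Qed.

Lemma letters_inj : injective (@letters_of G).
Proof. by move=> u v /val_inj/val_inj. Qed.

Lemma word_exists (s : seq G) :
  uniq s -> exists w : bstring G, letters_of w = s.
Proof.
move=> us; have sz : size s <= #|G| by rewrite -(card_uniqP us) max_card.
by exists (Sub (Bseq sz) us : bstring G).
Qed.

Lemma eq_orient h h' S :
  {in S &, forall a b, edge a b -> (h a < h b) = (h' a < h' b)} ->
  orient h S = orient h' S.
Proof.
move=> eq_h; apply/setP=> -[a b]; rewrite !inE /=.
by case Sa: (a \in S) => //=; case Sb: (b \in S) => //=; case e: edge => //=; apply: eq_h.
Qed.

Lemma restrict_orient S T h : restrict S (orient h T) = orient h (S :&: T).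
Proof.
apply/setP=> -[a b]; rewrite !inE /=.
by case: (a \in S); case: (b \in S); rewrite ?andbF ?andbT.
Qed.

Lemma restrict_restrict S T o : restrict S (restrict T o) = restrict (S :&: T) o.
Proof.
apply/setP=> -[a b]; rewrite !inE /=.
by case: (_ \in o); case: (a \in S); case: (b \in S); rewrite ?andbF ?andbT.
Qed.

(** A word is turned into a height function by taking positions, and a height
function into a word by sorting the vertices by height. *)
Lemma acyclicP S o :
  reflect (exists2 h, proper_height h S & o = orient h S) (o \in acyclic S).
Proof.
apply: (iffP imsetP) => [[w /[!inE]/eqP<- ->]|[h ph ->]].
  exists (index^~ (letters_of w)) => // a b; rewrite !inE => wa wb eab /= eq_ab.
  have: a = b by rewrite -(nth_index a wa) eq_ab nth_index.
  by move=> eqab; rewrite eqab edge_irr in eab.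
have [|w Ew] := @word_exists (sort (relpre h leq) (enum S)).
  by rewrite sort_uniq enum_uniq.
have ES : letter_set w = S by apply/setP=> x; rewrite inE Ew mem_sort mem_enum.
exists w; first by rewrite inE ES.
rewrite /arcs ES; apply: eq_orient => a b Sa Sb eab; rewrite Ew.
apply/esym/index_sorted; rewrite ?mem_sort ?mem_enum //; last exact/eqP/ph.
by apply: sort_sorted => x y /=; apply: leq_total.
Qed.

Inductive commute : seq G -> seq G -> Prop :=
| commute_refl s : commute s s
| commute_swap p a b q : ~~ edge a b ->
    commute (p ++ [:: a; b] ++ q) (p ++ [:: b; a] ++ q)
| commute_trans s t u : commute s t -> commute t u -> commute s u.

Lemma commute_cons c s t : commute s t -> commute (c :: s) (c :: t).
Proof.
elim=> [s'|p a b q nab|s' t' u _ st _ tu]; first exact: commute_refl.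
  exact: (@commute_swap (c :: p)).
exact: commute_trans st tu.
Qed.

Lemma commute_to_front p a q :
  {in p, forall c, ~~ edge c a} -> commute (p ++ a :: q) (a :: p ++ q).
Proof.
elim: p => [|c p IHp] nea; first exact: commute_refl.
have /(commute_cons c) IH : commute (p ++ a :: q) (a :: p ++ q).
  by apply: IHp => d pd; apply: nea; rewrite inE pd orbT.
apply: commute_trans IH _.
by apply: (@commute_swap [::]); apply: nea; rewrite inE eqxx.
Qed.

(** By induction on [t]: its first letter [a] commutes in [s] with everything
before it, since a neighbour of [a] preceding it in [s] would have to precede it
in [t] as well. So [a] can be moved to the front of [s] and stripped off. *)
Lemma commute_same_order (s t : seq G) :
  uniq s -> uniq t -> s =i t ->
  {in s &, forall a b, edge a b -> (index a s < index b s) = (index a t < index b t)} ->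
  commute s t.
Proof.
elim: t s => [|a t IHt] s us ut st ord.
  by case: s st {us ord} => [|x s] st; [exact: commute_refl | move: (st x); rewrite !inE eqxx].
have sa : a \in s by rewrite st inE eqxx.
case/splitPr: sa us st ord => p q us st ord.
have usub : subseq (p ++ q) (p ++ a :: q) by rewrite cat_subseq // subseq_cons.
have [an upq] : a \notin p ++ q /\ uniq (p ++ q).
  by move: us; rewrite -cat_rcons -cats1 -catA uniq_catCA /= => /andP[].
apply: commute_trans (commute_to_front _ _) (commute_cons a _).
  move=> c pc; apply/negP=> eca.
  have [cs as'] : c \in p ++ a :: q /\ a \in p ++ a :: q.
    by rewrite !mem_cat pc !inE eqxx orbT.
  have := ord _ _ cs as' eca; rewrite /= eqxx ltn0 !index_cat pc.
  move: an; rewrite mem_cat negb_or => /andP[/negbTE-> _] /=.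
  by rewrite eqxx addn0 index_mem pc.
case/andP: (ut) => ant ut'.
apply: IHt => // [x|x y px py exy].
  have := st x; rewrite !(inE, mem_cat).
  by case: (eqVneq x a) => [->|//]; move: an ant; rewrite mem_cat => /negbTE-> /negbTE->.
have eq_mem z : z \in p ++ q -> z \in t.
  move=> zpq; have := mem_subseq usub zpq; rewrite st inE => /orP[/eqP zz|//].
  by rewrite zz (negbTE an) in zpq.
rewrite (index_subseq us usub) // ord ?(mem_subseq usub) //.
by rewrite (@index_subseq _ t (a :: t)) ?subseq_cons ?eq_mem.
Qed.

(** Swapping [a] and [b] changes the relative order of no other pair. *)
Lemma swap_same_order (p : seq G) a b q c d :
  uniq (p ++ [:: a; b] ++ q) -> ~~ edge a b -> edge c d ->
  (index c (p ++ [:: a; b] ++ q) < index d (p ++ [:: a; b] ++ q)) =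
  (index c (p ++ [:: b; a] ++ q) < index d (p ++ [:: b; a] ++ q)).
Proof.
move=> us nab ecd; rewrite ![index _ (p ++ _)]index_cat /=.
have [nba ncd] : ~~ edge b a /\ c != d.
  rewrite edge_sym nab; split=> //; apply: contraTneq ecd => ->.
  by rewrite edge_irr.
case pc: (c \in p); case pd: (d \in p) => //.
- by rewrite !ltn_addr ?index_mem.
- have lt_d : index d p <= size p := index_size d p.
  by rewrite !ltnNge !(leq_trans lt_d) ?leq_addr.
rewrite !ltn_add2l.
have edc : edge d c by rewrite edge_sym.
case: (eqVneq a c) => [Ea|?]; case: (eqVneq b d) => [Eb|?];
  case: (eqVneq a d) => [Ec|?]; case: (eqVneq b c) => [Ed|?] //=; try subst a; try subst b;
  move: nab nba ncd; rewrite ?eqxx ?ecd ?edc //=.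
by rewrite -Ec eqxx.
Qed.

Definition code (w : bstring G) := (letter_set w, arcs w).

(** Commutation classes of words are acyclic orientations of induced
subgraphs. *)
Lemma codeP u v : reflect (code u = code v) (connect (@swap_step G) u v).
Proof.
apply: (iffP idP) => [/connectP[s]|[Elet Earc]].
  elim: s u => [u _ -> //|w s IHs u /= /andP[uw /IHs IH] /IH <-].
  case/existsP: uw => i /existsP[a] /existsP[b] /and3P[].
  move: (take _ _) (drop _ _) => p q /eqP Eu /eqP Ew nab.
  have Elet : letter_set w = letter_set u.
    apply/setP=> x; rewrite !inE Eu Ew !mem_cat !inE.
    by case: (x == a); case: (x == b); rewrite ?orbT.
  congr (_, _); first by rewrite Elet.
  rewrite /arcs Elet; apply: eq_orient => c d _ _ ecd.
  by rewrite Ew Eu swap_same_order // -?Ew -?Eu letters_uniq.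
(* Plain sequences are commuted first: the induction passes to tails. *)
have [s Es]: exists s, s = letters_of u by exists (letters_of u).
have [t Et]: exists t, t = letters_of v by exists (letters_of v).
have st : commute s t.
  have eq_mem : letters_of u =i letters_of v.
    by move=> x; move/setP: Elet => /(_ x); rewrite !inE.
  rewrite Es Et; apply: commute_same_order; rewrite ?letters_uniq //.
  move=> a b sa sb eab; move/setP: Earc => /(_ (a, b)).
  by rewrite !inE /= -!eq_mem sa sb eab.
(* Each intermediate sequence is duplicate-free, hence is again a word. *)
suff lift : commute s t -> forall u', letters_of u' = s ->
    exists2 v', letters_of v' = t & connect (@swap_step G) u' v'.
  have [v' Ev' uv] := lift st u (esym Es).
  by rewrite Et in Ev'; rewrite -(letters_inj Ev').
elim=> {s t Es Et st} [s u' Eu|p a b q nab u' Eu|s t r _ IHs _ IHt u' /IHs[v' /IHt[w' Ew vw] uv]].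
- by exists u' => //; exact: connect0.
- have us : uniq (p ++ [:: b; a] ++ q).
    have := letters_uniq u'; rewrite Eu.
    rewrite (perm_uniq (_ : perm_eq _ (p ++ [:: b; a] ++ q))) //.
    by rewrite perm_cat2l perm_cat2r (perm_catC [:: a]).
  have [v' Ev] := word_exists us; exists v' => //; apply: connect1.
  have sz : size p < #|G|.
    apply: leq_trans (max_card (mem (letters_of u'))).
    by rewrite (card_uniqP (letters_uniq u')) Eu !size_cat /= addnS ltnS leq_addr.
  apply/existsP; exists (Ordinal sz); apply/existsP; exists a; apply/existsP; exists b.
  rewrite /= Eu Ev take_size_cat // -addn2 addnC -drop_drop drop_size_cat //.
  by rewrite drop_size_cat //= ?drop0 !eqxx.
- by exists w' => //; exact: connect_trans uv vw.
Qed.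

End Orientations.

(** * Cells and faces of the boolean complex *)

Section Cells.

Variable G : sgraph.
Implicit Types (S : {set G}) (h : G -> nat) (o : {set G * G}).
Implicit Types (c d : {set bstring G}) (u v w : bstring G).

Definition cell_of w : {set bstring G} := [set v | code v == code w].

(** All words of a cell have the same arcs, so the union is this common value;
it avoids choosing a word. *)
Definition cell_arcs c : {set G * G} := \bigcup_(w in c) arcs w.

Lemma cell_of_in_poset w : cell_of w \in boolean_poset G.
Proof.
apply/imsetP; exists w; rewrite ?inE //; apply/setP=> v.
by rewrite !inE; apply/eqP/codeP => ->.
Qed.

Lemma poset_cell_of c : c \in boolean_poset G -> exists w, c = cell_of w.
Proof.
case/imsetP => w _ ->; exists w; apply/setP=> v.
by rewrite !inE; apply/codeP/eqP => ->.
Qed.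

Lemma letters_cell_of w : letters (cell_of w) = letter_set w.
Proof.
apply/setP=> x; rewrite !inE; apply/existsP/idP => [[v]|wx].
  by rewrite inE => /andP[/eqP[/setP/(_ x)]]; rewrite !inE => ->.
by exists w; rewrite inE eqxx.
Qed.

Lemma cell_arcs_of w : cell_arcs (cell_of w) = arcs w.
Proof.
apply/setP=> p; apply/bigcupP/idP => [[v]|pw]; first by rewrite inE => /eqP[_ <-].
by exists w; rewrite // inE.
Qed.

Lemma cell_inj c d : c \in boolean_poset G -> d \in boolean_poset G ->
  letters c = letters d -> cell_arcs c = cell_arcs d -> c = d.
Proof.
move=> /poset_cell_of[u ->] /poset_cell_of[v ->].
rewrite !letters_cell_of !cell_arcs_of => El Ea.
by apply/setP=> w; rewrite !inE /code El Ea.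
Qed.

Lemma cell_arcs_acyclic c :
  c \in boolean_poset G -> cell_arcs c \in acyclic (letters c).
Proof.
case/poset_cell_of => w ->; rewrite letters_cell_of cell_arcs_of.
by apply/imsetP; exists w; rewrite ?inE.
Qed.

Lemma acyclic_cell S o : o \in acyclic S ->
  exists2 c, c \in boolean_poset G & letters c = S /\ cell_arcs c = o.
Proof.
case/imsetP => w /[!inE]/eqP<- ->; exists (cell_of w); first exact: cell_of_in_poset.
by rewrite letters_cell_of cell_arcs_of.
Qed.

Lemma arcs_filter w w' (S : {set G}) :
  letters_of w' = [seq x <- letters_of w | x \in S] ->
  code w' = (S :&: letter_set w, restrict S (arcs w)).
Proof.
move=> Ew'; rewrite /arcs restrict_orient.
have El : letter_set w' = S :&: letter_set w.
  by apply/setP=> x; rewrite !inE Ew' mem_filter.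
rewrite /code /arcs El; congr (_, _); apply: eq_orient => a b Sa Sb _.
rewrite -(@index_subseq _ (letters_of w')) ?letters_uniq //.
- by rewrite Ew' filter_subseq.
- by move: Sa; rewrite -El inE.
- by move: Sb; rewrite -El inE.
Qed.

(** A subword of [u] with letter set [S] is [u] filtered by [S], and filtering
keeps relative positions. *)
Lemma face_leE c d : c \in boolean_poset G -> d \in boolean_poset G ->
  face_le d c = (letters d \subset letters c)
                && (cell_arcs d == restrict (letters d) (cell_arcs c)).
Proof.
move=> /poset_cell_of[u ->] /poset_cell_of[v ->].
rewrite !letters_cell_of !cell_arcs_of.
apply/existsP/andP => [[v']|[sub_vu /eqP Ev]].
  rewrite !inE => /andP[/eqP [<- <-]] /existsP[u'] /andP[].
  rewrite inE => /eqP[<- <-] sub.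
  have E : letters_of v' = [seq x <- letters_of u' | x \in letter_set v'].
    have /(subseq_uniqP (letters_uniq u')) E := sub.
    by rewrite [LHS]E; apply: eq_filter => x; rewrite inE.
  have [El ->] := arcs_filter E; split; last by [].
  by rewrite El subsetIr.
have [w Ew] := word_exists (filter_uniq (mem (letter_set v)) (letters_uniq u)).
have [El Ea] := arcs_filter Ew.
exists w; rewrite inE /code Ea El Ev (setIidPl sub_vu) eqxx /=.
by apply/existsP; exists u; rewrite inE eqxx Ew filter_subseq.
Qed.

End Cells.

(** * The rank of the space of top-dimensional cycles *)

Section FreeVectorSpace.

Local Open Scope ring_scope.

Variable P : finType.
Local Notation vec := 'rV[rat]_#|P|.

Definition basis_vec (p : P) : vec := delta_mx 0 (enum_rank p).

Definition family_mx (T : finType) (A : {set T}) (f : T -> P) :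
    'M[rat]_(#|A|, #|P|) :=
  \matrix_i basis_vec (f (enum_val i)).

(** The linear map, acting on row vectors, that pushes basis vectors forward
along [g]. *)
Definition fun_mx (g : P -> P) : 'M[rat]_#|P| :=
  \matrix_i basis_vec (g (enum_val i)).

Lemma basis_vec_fun p g : basis_vec p *m fun_mx g = basis_vec (g p).
Proof. by rewrite -rowE rowK enum_rankK. Qed.

Lemma fun_mx_comp g h : fun_mx g *m fun_mx h = fun_mx (h \o g).
Proof. by apply/row_matrixP=> i; rewrite row_mul !rowK basis_vec_fun. Qed.

Lemma eq_fun_mx g h : g =1 h -> fun_mx g = fun_mx h.
Proof. by move=> eq_gh; apply/row_matrixP=> i; rewrite !rowK eq_gh. Qed.

Lemma family_mx_fun (T : finType) (A : {set T}) (f : T -> P) g :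
  family_mx A f *m fun_mx g = family_mx A (g \o f).
Proof. by apply/row_matrixP=> i; rewrite row_mul !rowK basis_vec_fun. Qed.

Lemma eq_family_mx (T : finType) (A : {set T}) (f g : T -> P) :
  {in A, f =1 g} -> family_mx A f = family_mx A g.
Proof.
by move=> eq_fg; apply/row_matrixP=> i; rewrite !rowK eq_fg ?enum_valP.
Qed.

Lemma family_mx_sub (T U : finType) (A : {set T}) (B : {set U})
    (f : T -> P) (g : U -> P) :
  {in A, forall x, f x \in g @: B} -> (family_mx A f <= family_mx B g)%MS.
Proof.
move=> fA; apply/row_subP=> i; rewrite rowK.
have /imsetP[y By ->] := fA _ (enum_valP i).
have -> : basis_vec (g y) = row (enum_rank_in By y) (family_mx B g).
  by rewrite rowK enum_rankK_in.
exact: row_sub.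
Qed.

Lemma family_mx_free (T : finType) (A : {set T}) (f : T -> P) :
  {in A &, injective f} -> row_free (family_mx A f).
Proof.
move=> inj_f; apply/row_freeP; exists (family_mx A f)^T.
apply/matrixP=> i j; rewrite !mxE (bigD1 (enum_rank (f (enum_val i)))) //=.
rewrite big1 => [|k nk]; rewrite !mxE /= ?eqxx ?(negbTE nk) ?mul0r //.
rewrite mul1r addr0 (inj_eq enum_rank_inj); congr (_%:R).
congr (nat_of_bool _); apply/eqP/eqP => [|-> //].
by move=> /(inj_f _ _ (enum_valP i) (enum_valP j))/enum_val_inj.
Qed.

Lemma mul_family_mx (T : finType) (A : {set T}) (f : T -> P) (g : 'rV[rat]_#|A|) p :
  (g *m family_mx A f) 0 (enum_rank p) =
  \sum_(k | f (enum_val k) == p) g 0 k.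
Proof.
rewrite mxE [RHS]big_mkcond; apply: eq_bigr => k _.
rewrite !mxE /= (inj_eq enum_rank_inj) eq_sym.
by case: eqP; rewrite ?mulr1 ?mulr0.
Qed.

End FreeVectorSpace.

Section TopHomology.

Local Open Scope ring_scope.

Variable G : sgraph.
Implicit Types (S X : {set G}) (o : {set G * G}).

Definition delete (v : G) o := restrict (~: [set v]) o.

(** The orientation [o] of the graph on [S], extended to [v] by letting [v]
precede all its neighbours; on words, [v] is put in front. *)
Definition prepend (v : G) S o := o :|: [set p | [&& p.1 == v, p.2 \in S & edge v p.2]].

Lemma deleteC u v o : delete u (delete v o) = delete v (delete u o).
Proof. by rewrite /delete !restrict_restrict setIC. Qed.

Lemma delete_prepend u v S o : u != v ->
  delete u (prepend v S o) = prepend v (S :\ u) (delete u o).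
Proof.
move=> nuv; apply/setP=> -[a b]; rewrite !inE /=.
case: (eqVneq a v) => [->|nav] /=; last by rewrite !orbF.
rewrite eq_sym nuv /=.
by case: (b == u); rewrite ?andbF ?andbT.
Qed.

Lemma delete_prepend_same v S o : delete v (prepend v S o) = delete v o.
Proof.
apply/setP=> -[a b]; rewrite !inE /=.
by case: (eqVneq a v) => [->|nav] /=; rewrite ?andbF ?orbF.
Qed.

Lemma restrict_acyclic S T o : o \in acyclic T -> restrict S o \in acyclic (S :&: T).
Proof.
case/acyclicP => h ph ->; rewrite restrict_orient; apply/acyclicP; exists h => //.
by move=> a b /setIP[_ Ta] /setIP[_ Tb]; apply: ph.
Qed.

Lemma delete_acyclic v S o : o \in acyclic S -> delete v o \in acyclic (S :\ v).
Proof. by move/(restrict_acyclic (~: [set v])); rewrite setIC -setDE. Qed.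

Lemma restrict_acyclic_id S o : o \in acyclic S -> restrict S o = o.
Proof. by case/acyclicP => h _ ->; rewrite restrict_orient setIid. Qed.

Lemma delete_acyclic_id v S o : v \notin S -> o \in acyclic S -> delete v o = o.
Proof.
move=> vS So; rewrite /delete -(restrict_acyclic_id So) restrict_restrict.
by congr (restrict _ _); apply/setIidPr; rewrite subsetC sub1set inE.
Qed.

Lemma prepend_acyclic v S o : v \notin S -> o \in acyclic S -> prepend v S o \in acyclic (v |: S).
Proof.
move=> vS /acyclicP[h ph ->].
apply/acyclicP; exists (fun x => if x == v then 0%N else (h x).+1).
  move=> a b; rewrite !inE => /predU1P[->|Sa] /predU1P[->|Sb] eab; rewrite ?eqxx.
  - by rewrite edge_irr in eab.
  - by case: eqP => // Eb; rewrite -Eb Sb in vS.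
  - by case: eqP => // Ea; rewrite -Ea Sa in vS.
  - case: eqP => [Ea|_]; first by rewrite -Ea Sa in vS.
    case: eqP => [Eb|_]; first by rewrite -Eb Sb in vS.
    by case=> /(ph _ _ Sa Sb eab).
apply/setP=> -[a b]; rewrite !inE /=.
case: (eqVneq a v) => [->|nav] /=; rewrite ?(negbTE vS) /=.
  by case: (eqVneq b v) => [->|] //=; rewrite ?(negbTE vS) ?edge_irr ?andbF // andbT.
rewrite orbF; case: (eqVneq b v) => [->|nbv] //=.
by rewrite (negbTE vS) ltn0 !andbF.
Qed.

(** The span of the acyclic orientations of the graph induced on [S]. *)
Definition chains S := family_mx (acyclic S) id.

Definition delete_mx v := fun_mx (delete v).

(** The cycle conditions are imposed only for the vertices of [X], so that they
can be added one at a time; [cycles S S] is the space of top-dimensional cycles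
of the graph induced on [S]. *)
Definition cycles S X : 'M[rat]_#|{: {set G * G}}| :=
  (chains S :&: \bigcap_(u in X) kermx (delete_mx u))%MS.

Lemma sub_cycles m (A : 'M_(m, _)) S X :
  reflect ((A <= chains S)%MS /\ forall u, u \in X -> A *m delete_mx u = 0)
          (A <= cycles S X)%MS.
Proof.
rewrite sub_capmx; apply: (iffP andP) => -[AS AX]; split=> //.
  by move=> u Xu; apply/sub_kermxP; move/sub_bigcapmxP: AX; apply.
by apply/sub_bigcapmxP => u Xu; apply/sub_kermxP/AX.
Qed.

Lemma chains_delete S v : (chains S *m delete_mx v <= chains (S :\ v))%MS.
Proof.
rewrite family_mx_fun; apply: family_mx_sub => o So /=.
by rewrite imset_id delete_acyclic.
Qed.

(** Deletion of [v] commutes with the conditions at the vertices of [X], which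
gives one inclusion. For the other, every element of [cycles (S :\ v) X] is
recovered by deletion from its image under [prepend v], which still satisfies
the conditions at [X] by [delete_prepend]. *)
Lemma cycles_delete S X v : v \in S -> v \notin X ->
  (cycles S X *m delete_mx v :=: cycles (S :\ v) X)%MS.
Proof.
move=> Sv Xv; apply/eqmxP/andP; split.
  have /sub_cycles[CS CX] := submx_refl (cycles S X).
  apply/sub_cycles; split=> [|u Xu].
    exact: submx_trans (submxMr _ CS) (chains_delete S v).
  rewrite -mulmxA fun_mx_comp (eq_fun_mx (deleteC u v)) -fun_mx_comp.
  by rewrite mulmxA CX // mul0mx.
have /sub_cycles[CS CX] := submx_refl (cycles (S :\ v) X).
have sv : v \notin S :\ v by rewrite !inE eqxx.
have chK : chains (S :\ v) *m delete_mx v = chains (S :\ v).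
  by rewrite family_mx_fun; apply: eq_family_mx => o /=; apply: delete_acyclic_id.
have cyK : cycles (S :\ v) X *m delete_mx v = cycles (S :\ v) X.
  by case/submxP: CS => Z ->; rewrite -mulmxA chK.
have ED : delete_mx v = fun_mx (prepend v (S :\ v)) *m delete_mx v.
  by rewrite fun_mx_comp; apply: eq_fun_mx => o /=; rewrite delete_prepend_same.
rewrite -{1}cyK {1}ED mulmxA.
apply/submxMr/sub_cycles; split=> [|u Xu].
  apply: submx_trans (submxMr _ CS) _.
  rewrite family_mx_fun; apply: family_mx_sub => o So /=.
  by rewrite imset_id -{2}(setD1K Sv) prepend_acyclic.
have nuv : u != v by apply: contraNneq Xv => <-.
rewrite -mulmxA fun_mx_comp (eq_fun_mx (h := prepend v (S :\ v :\ u) \o delete u)); last first.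
  by move=> o /=; rewrite delete_prepend.
by rewrite -fun_mx_comp mulmxA CX // mul0mx.
Qed.

Lemma rank_cycles_insert S X v : v \in S -> v \notin X ->
  (\rank (cycles S X) = \rank (cycles S (v |: X)) + \rank (cycles (S :\ v) X))%N.
Proof.
move=> Sv Xv; rewrite -(mxrank_mul_ker (cycles S X) (delete_mx v)).
rewrite (cycles_delete Sv Xv) addnC; congr (_ + _)%N.
by rewrite /cycles big_setU1 //= -capmxA; congr (\rank (_ :&: _)%MS); apply: capmxC.
Qed.

Lemma rank_cycles0 S : \rank (cycles S set0) = #|acyclic S|.
Proof.
rewrite /cycles big_set0 (capmx_idPl (submx1 _)).
by apply/eqP/family_mx_free => x y _ _.
Qed.

End TopHomology.

(** * The boolean number as an alternating sum *)

Section AlternatingSums.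

Local Open Scope ring_scope.

Variable T : finType.
Implicit Types (S U X : {set T}) (a : {set T} -> int).

Definition alternating a U : int :=
  \sum_(S : {set T} | S \subset U) (-1) ^+ #|U :\: S| * a S.

Lemma alternating_insert a v U : v \notin U ->
  alternating a (v |: U) =
  \sum_(S : {set T} | S \subset U) (-1) ^+ #|U :\: S| * (a (v |: S) - a S).
Proof.
move=> Uv; rewrite /alternating (bigID (fun S => v \in S)) /=.
under [RHS]eq_bigr do rewrite mulrBr.
rewrite sumrB; congr (_ + _).
  rewrite (reindex_onto (fun S => v |: S) (fun S => S :\ v)) => [|S /andP[_ /setD1K//]].
  apply: eq_big => [S|S]; last first.
    case/andP=> _ /eqP E; congr (_ ^+ #|pred_of_set _| * _).
    apply/setP=> x; rewrite !inE; case: (eqVneq x v) => [->|] //=.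
    by rewrite (negbTE Uv) andbF.
  rewrite setU11 andbT subUset sub1set setU11 /=.
  apply/andP/idP => [[sub /eqP E]|sub].
    have Sv : v \notin S by rewrite -E !inE eqxx.
    apply/subsetP=> x Sx; case/setU1P: (subsetP sub x Sx) => [Ex|//].
    by rewrite Ex (negbTE Sv) in Sx.
  have Sv : v \notin S by apply: contra Uv; apply: subsetP.
  by rewrite (setU1K Sv) (subset_trans sub) ?subsetUr.
rewrite -sumrN; apply: eq_big => [S|S].
  apply/andP/idP => [[sub Sv]|sub].
    apply/subsetP=> x Sx; case/setU1P: (subsetP sub x Sx) => [E|//].
    by rewrite -E Sx in Sv.
  by rewrite (subset_trans sub) ?subsetUr //; split=> //; apply: contra Uv; apply: subsetP.
case/andP=> _ Sv.
have -> : (v |: U) :\: S = v |: (U :\: S).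
  by apply/setP=> x; rewrite !inE; case: (eqVneq x v) => [->|] //=; rewrite Sv.
by rewrite cardsU1 !inE (negbTE Uv) andbF /= exprS mulN1r mulNr.
Qed.

End AlternatingSums.

Section BooleanNumber.

Local Open Scope ring_scope.

Variable G : sgraph.
Implicit Types (S X U : {set G}) (o : {set G * G}).

Definition num_acyclic S : int := (#|acyclic S|)%:Z.

(** The recursion of [rank_cycles_insert] unfolded: every vertex of [X] is
either kept or removed, each removal contributing a sign. *)
Lemma rank_cycles_sum S X : X \subset S ->
  (\rank (cycles S X))%:Z =
  \sum_(U : {set G} | (S :\: X \subset U) && (U \subset S))
     (-1) ^+ #|S :\: U| * num_acyclic U.
Proof.
move: {2}#|X| (leqnn #|X|) => n; elim: n S X => [|n IHn] S X.
  rewrite leqn0 cards_eq0 => /eqP-> _; rewrite rank_cycles0.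
  rewrite (big_pred1 S) ?setDv ?cards0 ?mul1r // => U /=.
  by rewrite setD0 eqEsubset andbC.
case: (set_0Vmem X) => [->|[v Xv]]; first by move=> _ subX; apply: IHn; rewrite ?cards0.
rewrite (cardsD1 v) Xv add1n ltnS => leX subX.
have Sv := subsetP subX v Xv.
have := @rank_cycles_insert G S (X :\ v) v Sv; rewrite !inE eqxx setD1K //.
move=> /(_ isT) E.
have -> : (\rank (cycles S X))%:Z =
    (\rank (cycles S (X :\ v)))%:Z - (\rank (cycles (S :\ v) (X :\ v)))%:Z.
  by rewrite E PoszD addrK.
have subS : X :\ v \subset S := subset_trans (subsetDl _ _) subX.
rewrite !IHn ?setSD // [RHS](bigID (fun U => v \in U)) /=.
congr (_ + _); last rewrite -sumrN.
  apply: eq_bigl => U; rewrite andbAC; congr (_ && _).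
  have -> : S :\: (X :\ v) = v |: (S :\: X).
    by apply/setP=> x; rewrite !inE; case: (eqVneq x v) => [->|] //=; rewrite Sv.
  by rewrite subUset sub1set andbC.
apply: eq_big => [U|U /andP[_]].
  rewrite subsetD1 andbA; congr (_ && _ && _).
  by rewrite setDDl setD1K.
rewrite subsetD1 => /andP[_ Uv].
have -> : S :\: U = v |: (S :\ v :\: U).
  by apply/setP=> x; rewrite !inE; case: (eqVneq x v) => [->|] //=; rewrite ?andbT // Uv Sv.
by rewrite cardsU1 !inE eqxx andbF /= exprS mulN1r mulNr.
Qed.

Lemma cells_top c : c \in cells G #|G| -> c \in boolean_poset G /\ letters c = [set: G].
Proof.
rewrite inE => /andP[-> /eqP card_c]; split=> //.
by apply/eqP; rewrite eqEcard subsetT cardsT card_c leqnn.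
Qed.

Lemma incidence_top c d u : c \in cells G #|G| -> d \in boolean_poset G ->
  letters d = ~: [set u] ->
  incidence c d = (-1) ^+ #|[set w : G | (enum_rank w < enum_rank u)%N]|
                  * (delete u (cell_arcs c) == cell_arcs d)%:R.
Proof.
move=> /cells_top[Pc Lc] Pd Ld.
rewrite /incidence face_leE // Lc Ld subsetT /= cardsT cardsC1.
rewrite prednK ?eqxx ?andbT; last by apply/card_gt0P; exists u.
rewrite /delete [in LHS]eq_sym; case: eqP => _; rewrite ?mulr0 // mulr1.
rewrite setTD setCK big_set1; congr (_ ^+ #|pred_of_set _|).
by apply/setP=> w; rewrite !inE.
Qed.

(** The coefficient of [g *m boundary] at a facet [d] missing [u] is, up to a
sign depending on [u] only, the coefficient of the push-forward of [g] under the
deletion of [u] at the orientation [cell_arcs d]. *)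
Lemma boundary_top_kernel (g : 'rV_#|cells G #|G| |) :
  g *m boundary G #|G| = 0 <->
  forall u, g *m family_mx (cells G #|G|) (delete u \o @cell_arcs G) = 0.
Proof.
have entry d (Pd : d \in cells G #|G|.-1) u : letters d = ~: [set u] ->
    (g *m boundary G #|G|) 0 (enum_rank_in Pd d) =
    (-1) ^+ #|[set w : G | (enum_rank w < enum_rank u)%N]| *
    (g *m family_mx (cells G #|G|) (delete u \o @cell_arcs G)) 0 (enum_rank (cell_arcs d)).
  move=> Ld; rewrite mul_family_mx mxE big_distrr /= [RHS]big_mkcond /=.
  apply: eq_bigr => k _; rewrite mxE enum_rankK_in // (incidence_top _ _ Ld) ?enum_valP //.
    by case: eqP => _; rewrite ?mulr1 ?mulr0 // mulrC.
  by move: Pd; rewrite inE => /andP[].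
split=> [gB u|gD].
  apply/rowP=> p; rewrite -(enum_valK p) [RHS]mxE.
  case: (boolP (enum_val p \in acyclic (~: [set u]))) => [/acyclic_cell[d Pd [Ld Ed]]|np].
    have Cd : d \in cells G #|G|.-1 by rewrite inE Pd Ld cardsC1 /=.
    move/eqP: (entry d Cd u Ld); rewrite gB mxE eq_sym mulf_eq0 signr_eq0 Ed.
    by move/eqP.
  rewrite mul_family_mx big_pred0 // => k; apply: contraNF np => /eqP<- /=.
  have [Pc Lc] := cells_top (enum_valP k).
  by move: (delete_acyclic u (cell_arcs_acyclic Pc)); rewrite Lc setTD.
apply/rowP=> j; rewrite [RHS]mxE.
have := enum_valP j; set d := enum_val j => Cd.
(* Without vertices [#|G|.-1] is [#|G|], and there is no incident pair. *)
case: (posnP #|G|) => [G0|G_gt0].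
  rewrite mxE big1 // => k _; rewrite mxE /incidence.
  have /setIdP[_ /eqP->] := Cd; have /setIdP[_ /eqP->] := enum_valP k.
  have -> : (#|G| == #|G|.-1.+1) = false by rewrite G0.
  by rewrite andbF mulr0.
have /cards1P[u Eu] : #|~: letters d| == 1%N.
  have /setIdP[_ /eqP cd] := Cd.
  by rewrite cardsCs setCK cd; move: G_gt0; case: #|G| => // n _; rewrite /= subSnn.
have -> : j = enum_rank_in Cd d by rewrite /d enum_valK_in.
by rewrite (entry d Cd u) -?Eu ?setCK // gD mxE mulr0.
Qed.

(** No chain has dimension [#|G|], so the top homology is the kernel of the
boundary. *)
Lemma boolean_number_cycles :
  boolean_number G = \rank (cycles [set: G] [set: G]).
Proof.
rewrite /boolean_number /reduced_betti.
have -> : \rank (boundary G #|G|.+1) = 0%N.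
  apply/eqP; rewrite -leqn0; apply: leq_trans (rank_leq_row _) _.
  rewrite leqn0 cards_eq0; apply/eqP/setP=> c; rewrite !inE.
  by apply/negbTE; rewrite negb_and orbC neq_ltn ltnS max_card.
rewrite subn0; set E := family_mx (cells G #|G|) (@cell_arcs G).
have freeE : row_free E.
  apply: family_mx_free => c d /cells_top[Pc Lc] /cells_top[Pd Ld] Ecd.
  by apply: cell_inj; rewrite ?Lc ?Ld.
rewrite -(mxrankMfree _ freeE); apply/eqmx_rank/andP; split.
  apply/sub_cycles; split=> [|u _].
    apply: submx_trans (submxMl _ _) _; apply: family_mx_sub => c /cells_top[Pc Lc].
    by rewrite imset_id -Lc cell_arcs_acyclic.
  rewrite -mulmxA family_mx_fun; apply/row_matrixP=> i; rewrite row_mul row0.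
  have /boundary_top_kernel -> // : row i (kermx (boundary G #|G|)) *m boundary G #|G| = 0.
  by rewrite -row_mul mulmx_ker row0.
apply/row_subP=> i; have /sub_cycles[Ci Cu] := row_sub i (cycles [set: G] [set: G]).
have /(submx_trans Ci)/submxP[g Eg] : (chains [set: G] <= E)%MS.
  apply: family_mx_sub => o /acyclic_cell[c Pc [Lc Ec]].
  by apply/imsetP; exists c; rewrite // inE Pc Lc cardsT /=.
rewrite Eg submxMr //; apply/sub_kermxP/boundary_top_kernel => u.
by rewrite -family_mx_fun mulmxA -Eg Cu.
Qed.

(** This is the reduced Euler characteristic of the complex up to sign, [S]
ranging over the possible vertex sets of the cells. *)
Lemma boolean_numberE :
  (boolean_number G)%:Z = alternating num_acyclic [set: G].
Proof.
rewrite boolean_number_cycles rank_cycles_sum // /alternating; apply: eq_bigl => U.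
by rewrite setDv sub0set.
Qed.

End BooleanNumber.

(** * Vertices whose neighbours are twins *)

Lemma raised_lt p q r : r <> q -> (p < q -> r <= q) ->
  (maxn (4 * p) (4 * r + 2) < 4 * q) = (p < q).
Proof. lia. Qed.

Lemma lt_raised p q r : r <> q -> p <> q -> (p < q -> r <= q) ->
  (4 * q < maxn (4 * p) (4 * r + 2)) = (q < p).
Proof. lia. Qed.

Section TwinNeighbours.

Variables (G : sgraph) (x : G).
Implicit Types (S L U : {set G}) (h : G -> nat) (o : {set G * G}).

Definition neighbours : {set G} := [set y | edge x y].

Hypothesis twins : {in neighbours &, forall y y', @edge G y =1 edge y'}.

Lemma neighbours_independent y y' :
  y \in neighbours -> y' \in neighbours -> edge y y' = false.
Proof. by move=> Ny Ny'; rewrite (twins Ny Ny') edge_irr. Qed.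

(** The maximal elements, for the relation [y -> z -> y'], among the neighbours
that precede [x]. *)
Definition top_level o : {set G} :=
  [set y | ((y, x) \in o) &&
     [forall y', forall z, ((y', x) \in o) ==> ~~ (((y, z) \in o) && ((z, y') \in o))]].

Lemma top_levelP S h y : x \notin S ->
  reflect [/\ y \in S, y \in neighbours, h y < h x &
    forall y' z, y' \in S -> y' \in neighbours -> h y' < h x ->
      z \in S -> edge y z -> h y < h z -> h y' <= h z]
    (y \in top_level (orient h (x |: S))).
Proof.
move=> xS; rewrite [_ \in top_level _]in_set.
have inD v : ((v, x) \in orient h (x |: S)) = [&& v \in S, v \in neighbours & h v < h x].
  rewrite !inE /= eqxx (edge_sym v); case: (eqVneq v x) => [->|] //=.
  by rewrite edge_irr (negbTE xS).
rewrite inD; apply: (iffP andP) => [[/and3P[Sy Ny hy] /forallP top]|[Sy Ny hy top]].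
  split=> // y' z Sy' Ny' hy' Sz eyz hyz.
  move/(_ y')/forallP/(_ z): top; rewrite inD Sy' Ny' hy' /= !inE /= Sy Sy' Sz eyz hyz !orbT /=.
  have -> : edge z y' by rewrite edge_sym (twins Ny' Ny).
  by rewrite -leqNgt.
split; first exact/and3P.
apply/forallP=> y'; apply/forallP=> z; apply/implyP; rewrite inD => /and3P[Sy' Ny' hy'].
rewrite !inE /=; apply/negP.
case/andP=> /and4P[_ Sz eyz hyz] /and4P[_ _ ezy hzy].
case/predU1P: Sz => [Ez|Sz]; first by rewrite Ez ltnNge (ltnW hy') in hzy.
by rewrite ltnNge (top y' z) in hzy.
Qed.

Section FixedLevel.

Variables (S L : {set G}) (l : G).
Hypotheses (xS : x \notin S) (Ll : l \in L).
Hypotheses (LS : L \subset S) (LN : L \subset neighbours).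

Local Notation S' := (l |: S :\: L).

(** When [L] is the top level, its elements compare in the same way with every
other vertex, so that they may be identified with [l]. *)
Definition merge v := if v \in L then l else v.

(** The neighbours of [x] in the levels strictly below the one of [l]. *)
Definition below h y := [exists z, [&& z \in S, edge l z, h y < h z & h z < h l]].

Lemma belowP h y :
  reflect (exists z, [/\ z \in S, edge l z, h y < h z & h z < h l]) (below h y).
Proof. by apply: (iffP existsP) => -[z /and4P ?]; exists z. Qed.

Lemma merge_in v : v \in S -> merge v \in S'.
Proof.
by move=> Sv; rewrite /merge; case: ifP => vL; rewrite !inE ?eqxx // vL Sv orbT.
Qed.

Lemma merge_edge a b : edge a b -> edge (merge a) (merge b).
Proof.
have Nl := subsetP LN l Ll.
move=> eab; rewrite /merge; case: ifP => La; case: ifP => Lb //.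
- by rewrite (neighbours_independent (subsetP LN a La) (subsetP LN b Lb)) in eab.
- by rewrite (twins Nl (subsetP LN a La)).
- by rewrite edge_sym (twins Nl (subsetP LN b Lb)) edge_sym.
Qed.

(** If [y] and [l] are both in the top level and [z] lies above [y], then [z]
lies above [l]: otherwise [y -> z -> l] contradicts the maximality of [y]. *)
Lemma top_level_merge h a b : proper_height h (x |: S) ->
  top_level (orient h (x |: S)) = L -> a \in S -> b \in S -> edge a b ->
  (h a < h b) = (h (merge a) < h (merge b)).
Proof.
move=> ph topL.
have Nl := subsetP LN l Ll; have Sl := subsetP LS l Ll.
have cmp y z : y \in L -> z \in S -> edge y z -> h y < h z -> h l < h z.
  move=> Ly Sz eyz hyz.
  have Ny := subsetP LN y Ly.
  have := Ll; rewrite -topL => /(top_levelP _ _ xS)[_ _ hl _].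
  have := Ly; rewrite -topL => /(top_levelP _ _ xS)[_ _ _ top].
  have elz : edge l z by rewrite (twins Nl Ny).
  rewrite ltn_neqAle (top l z) // andbT; apply/eqP.
  by apply: ph; rewrite // !inE ?Sl ?Sz orbT.
have cmp' y z : y \in L -> z \in S -> edge y z -> h l < h z -> h y < h z.
  move=> Ly Sz eyz hlz.
  have [Ny Sy] := (subsetP LN y Ly, subsetP LS y Ly).
  have := Ly; rewrite -topL => /(top_levelP _ _ xS)[_ _ hy _].
  have := Ll; rewrite -topL => /(top_levelP _ _ xS)[_ _ _ top].
  have elz : edge l z by rewrite (twins Nl Ny).
  rewrite ltn_neqAle (top y z) // andbT; apply/eqP.
  by apply: ph; rewrite // !inE ?Sy ?Sz orbT.
have cmpE y z : y \in L -> z \in S -> edge y z -> (h y < h z) = (h l < h z).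
  by move=> Ly Sz eyz; apply/idP/idP; [apply: cmp | apply: cmp'].
have neq y z : y \in S -> z \in S -> edge y z -> (h z < h y) = ~~ (h y < h z).
  move=> Sy Sz eyz; rewrite -leqNgt ltn_neqAle; case: eqP => //= E.
  by case: (ph y z (setU1r _ Sy) (setU1r _ Sz) eyz); rewrite E.
move=> Sa Sb eab; rewrite /merge; case: ifP => La; case: ifP => Lb //.
- by rewrite (neighbours_independent (subsetP LN a La) (subsetP LN b Lb)) in eab.
- exact: cmpE.
have eba : edge b a by rewrite edge_sym.
have elb : edge l a by rewrite (twins Nl (subsetP LN b Lb)).
by rewrite !(neq _ a) // cmpE.
Qed.

(** If [y] precedes [x] without being maximal, there is a path [y -> z -> y']
with [y'] preceding [x]; then [z] precedes [l], since otherwise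
[l -> z -> y'] contradicts the maximality of [l]. *)
Lemma top_level_below h y : proper_height h (x |: S) ->
  top_level (orient h (x |: S)) = L -> y \in S -> y \in neighbours ->
  (h y < h x) = (y \in L) || below h y.
Proof.
move=> ph topL Sy Ny.
have Nl := subsetP LN l Ll; have Sl := subsetP LS l Ll.
have /(top_levelP _ _ xS)[_ _ hl topl] : l \in top_level (orient h (x |: S)).
  by rewrite topL.
apply/idP/orP => [hy|[|/belowP[z [Sz elz hyz hzl]]]].
- case: (boolP (y \in L)) => yL; [by left | right].
  apply: contraR yL => /existsPn nbelow; rewrite -topL; apply/(top_levelP _ _ xS).
  split=> // y' z Sy' Ny' hy' Sz eyz hyz.
  have elz : edge l z by rewrite (twins Nl Ny).
  move: (nbelow z); rewrite Sz elz hyz /= -leqNgt => hlz.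
  apply: topl => //; rewrite ltn_neqAle hlz andbT.
  by apply/eqP/ph; rewrite // !inE ?Sl ?Sz orbT.
- by rewrite -topL => /(top_levelP _ _ xS)[].
- exact: ltn_trans hyz (ltn_trans hzl hl).
Qed.

(** An orientation with top level [L] can be recovered after removing [x] and
merging [L]: [top_level_merge] gives back the arcs between the vertices of [S],
and [top_level_below] those at [x]. *)
Lemma restrict_top_level_inj :
  {in [set o in acyclic (x |: S) | top_level o == L] &, injective (restrict S')}.
Proof.
move=> o1 o2 /[!inE] /andP[/acyclicP[h1 p1 ->] /eqP t1] /andP[/acyclicP[h2 p2 ->] /eqP t2].
have SS : S' :&: (x |: S) = S'.
  apply/setIidPl; rewrite subUset sub1set !inE (subsetP LS l Ll) orbT /=.
  by apply: subset_trans (subsetDl _ _) (subsetUr _ _).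
rewrite !restrict_orient SS => E.
have eqS' a b : a \in S' -> b \in S' -> edge a b -> (h1 a < h1 b) = (h2 a < h2 b).
  move=> Sa Sb eab; move/setP/(_ (a, b)): E.
  by rewrite [_ \in _]inE [in RHS]inE /= Sa Sb eab.
have eqS a b : a \in S -> b \in S -> edge a b -> (h1 a < h1 b) = (h2 a < h2 b).
  move=> Sa Sb eab; rewrite (top_level_merge p1 t1) // (top_level_merge p2 t2) //.
  by apply: eqS'; rewrite ?merge_in ?merge_edge.
have Nl := subsetP LN l Ll; have Sl := subsetP LS l Ll.
have eqx y : y \in S -> edge x y -> (h1 y < h1 x) = (h2 y < h2 x).
  move=> Sy exy; have Ny : y \in neighbours by rewrite inE.
  rewrite (top_level_below p1 t1) // (top_level_below p2 t2) //; congr (_ || _).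
  apply: eq_existsb => z; case Sz: (z \in S) => //=; case elz: (edge l z) => //=.
  by rewrite eqS // ?(twins Ny Nl) // (eqS z) // edge_sym.
apply: eq_orient => a b; rewrite !inE => /predU1P[->|Sa] /predU1P[->|Sb] eab.
- by rewrite !ltnn.
- have neq h : proper_height h (x |: S) -> (h x < h b) = ~~ (h b < h x).
    move=> ph; rewrite -leqNgt ltn_neqAle; case: eqP => //= E'.
    by case: (ph x b (setU11 _ _) (setU1r _ Sb) eab); rewrite E'.
  by rewrite !neq // eqx.
- by apply: eqx; rewrite // edge_sym.
- exact: eqS.
Qed.

(** The height function that undoes the merging. All of [L] is put at the
height of [l], and [x] just above. A neighbour of [x] outside [L] that is not
strictly below [l] has to come after [x]: it is raised, if necessary, to a height
just above [x], which leaves its relations with the other vertices unchanged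
because none of its neighbours in [S] lies between its old height and that of
[l]. The factor 4 makes room between consecutive integers for [x] and the
raised vertices. *)
Definition raise h v :=
  if v == x then 4 * h l + 1
  else if v \in L then 4 * h l
  else if (v \in neighbours) && ~~ below h v then maxn (4 * h v) (4 * h l + 2)
  else 4 * h v.

Lemma raise_merge h a b : proper_height h S' -> a \in S -> b \in S -> edge a b ->
  (raise h a < raise h b) = (h (merge a) < h (merge b)).
Proof.
move=> ph Sa Sb eab; have eba : edge b a by rewrite edge_sym.
have nx v : v \in S -> (v == x) = false by move=> Sv; apply: contraNF xS => /eqP<-.
have Nl := subsetP LN l Ll.
have := ph _ _ (merge_in Sb) (merge_in Sa) (merge_edge eba).
have nL v : v \notin neighbours -> (v \in L) = false.
  by move=> Nv; apply: contraNF Nv => Lv; apply: subsetP LN v Lv.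
have nb y z : z \in S -> edge l z -> ~~ below h y -> h y < h z -> h l <= h z.
  by move=> Sz elz /existsPn/(_ z); rewrite Sz elz /= negb_and => + hyz; rewrite hyz /= -leqNgt.
rewrite /raise /merge !nx //.
case: (boolP (a \in neighbours)) => Na; case: (boolP (b \in neighbours)) => Nb.
- by rewrite neighbours_independent in eab.
- rewrite (nL b) //=; case: ifP => aL; first by rewrite ltn_pmul2l.
  have elb : edge l b by rewrite (twins Nl Na).
  have plb : h l <> h b by apply: ph; rewrite // !inE ?eqxx // (nL b) // Sb orbT.
  by case: ifP => [/(nb _ _ Sb elb)/(raised_lt plb)|_] //; rewrite ltn_pmul2l.
- rewrite (nL a) //=; case: ifP => bL; first by rewrite ltn_pmul2l.
  have elb : edge l a by rewrite (twins Nl Nb) edge_sym.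
  have plb : h l <> h a by apply: ph; rewrite // !inE ?eqxx // (nL a) // Sa orbT.
  by case: ifP => [/(nb _ _ Sa elb)/(lt_raised plb)|_]; [apply|rewrite ltn_pmul2l].
- by rewrite !nL //= ltn_pmul2l.
Qed.

Lemma restrict_top_level_surj h : proper_height h S' ->
  exists2 o, o \in [set o in acyclic (x |: S) | top_level o == L]
           & restrict S' o = orient h S'.
Proof.
move=> ph.
have nx v : v \in S -> (v == x) = false by move=> Sv; apply: contraNF xS => /eqP<-.
have Nl := subsetP LN l Ll; have Sl := subsetP LS l Ll.
have lx : raise h x = 4 * h l + 1 by rewrite /raise eqxx.
have cmpx y : y \in S -> y \in neighbours ->
    raise h y != raise h x /\ (raise h y < raise h x) = (y \in L) || below h y.
  move=> Sy Ny; rewrite lx /raise nx // Ny.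
  case: ifP => Ly /=; first by split; clear; lia.
  case: (boolP (below h y)) => /= [/belowP[z [_ _ hyz hzl]]|_].
    by move: (ltn_trans hyz hzl); clear=> hyl; split; lia.
  by split; clear; lia.
exists (orient (raise h) (x |: S)); last first.
  have -> : restrict S' (orient (raise h) (x |: S)) = orient (raise h) S'.
    rewrite restrict_orient; congr orient.
    apply/setIidPl; rewrite subUset sub1set !inE Sl orbT /=.
    by apply: subset_trans (subsetDl _ _) (subsetUr _ _).
  have SS a : a \in S' -> (a \in S) && (merge a == a).
    rewrite !inE /merge => /orP[/eqP->|/andP[aL ->]]; first by rewrite Sl Ll eqxx.
    by rewrite (negbTE aL) eqxx.
  apply: eq_orient => a b /SS/andP[Sa /eqP ma] /SS/andP[Sb /eqP mb] eab.
  by rewrite raise_merge // ma mb.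
rewrite inE; apply/andP; split.
  apply/acyclicP; exists (raise h) => // a b.
  rewrite !inE => /predU1P[->|Sa] /predU1P[->|Sb] eab.
  - by rewrite edge_irr in eab.
  - by apply/eqP; rewrite eq_sym; case: (cmpx b) => //; rewrite inE.
  - by apply/eqP; case: (cmpx a) => //; rewrite inE edge_sym.
  - move=> E; have eba : edge b a by rewrite edge_sym.
    have := raise_merge ph Sa Sb eab; have := raise_merge ph Sb Sa eba.
    have := ph _ _ (merge_in Sa) (merge_in Sb) (merge_edge eab).
    by rewrite E !ltnn; clear; lia.
apply/eqP/setP=> y; apply/(top_levelP _ _ xS)/idP => [[Sy Ny hy top]|Ly].
  apply: contraTT hy => yL; have [_ ->] := cmpx y Sy Ny; rewrite (negbTE yL) /=.
  apply/belowP=> -[z [Sz elz hyz hzl]].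
  have [_ ltl] := cmpx l Sl Nl.
  have eyz : edge y z by rewrite (twins Ny Nl).
  have zL : z \in L = false.
    by apply: contraTF elz => Lz; rewrite neighbours_independent ?(subsetP LN).
  have := top l z Sl Nl; rewrite ltl Ll => /(_ isT Sz eyz).
  rewrite raise_merge // /merge (negbTE yL) zL => /(_ hyz).
  by rewrite leqNgt raise_merge ?(edge_sym z) // /merge Ll zL hzl.
have [Sy Ny] := (subsetP LS y Ly, subsetP LN y Ly).
have [_ ly] := cmpx y Sy Ny.
split; rewrite ?ly ?Ly // => y' z Sy' Ny' hy' Sz eyz.
have -> : raise h y = 4 * h l by rewrite /raise nx // Ly.
suff : raise h y' <= 4 * h l by move: (raise h) => h'; clear; lia.
have [_] := cmpx y' Sy' Ny'; rewrite hy' /raise nx // Ny'.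
case: ifP => //= _ /esym E; rewrite E /=.
by case/belowP: E => z' [_ _ hyz hzl]; rewrite leq_pmul2l // ltnW // (ltn_trans hyz).
Qed.

Lemma card_top_level :
  #|[set o in acyclic (x |: S) | top_level o == L]| = #|acyclic S'|.
Proof.
rewrite -(card_in_imset restrict_top_level_inj); congr #|pred_of_set _|.
apply/setP=> o; apply/imsetP/idP => [[o' /[!inE]/andP[Ho' _] ->]|/acyclicP[h ph ->]].
  have SS : S' :&: (x |: S) = S'.
    apply/setIidPl; rewrite subUset sub1set !inE (subsetP LS l Ll) orbT /=.
    by apply: subset_trans (subsetDl _ _) (subsetUr _ _).
  by have := restrict_acyclic S' Ho'; rewrite SS.
by have [o' Ho' Eo'] := restrict_top_level_surj ph; exists o'.
Qed.

End FixedLevel.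

(** If the top level is empty, no neighbour precedes [x], since a highest one
would be maximal; so [x] comes before all its neighbours. *)
Lemma card_top_level0 S : x \notin S ->
  #|[set o in acyclic (x |: S) | top_level o == set0]| = #|acyclic S|.
Proof.
move=> xS.
have inj : {in acyclic S &, injective (prepend x S)}.
  move=> o1 o2 S1 S2 /(congr1 (delete x)).
  by rewrite !delete_prepend_same !(delete_acyclic_id xS).
rewrite -(card_in_imset inj); congr #|pred_of_set _|.
apply/setP=> o; rewrite !inE; apply/andP/imsetP => [[/acyclicP[h ph ->] /eqP top0]|[o' So' ->]].
  exists (orient h S); first by apply/acyclicP; exists h => // a b Sa Sb; apply: ph; apply: setU1r.
  have hx y : y \in S -> y \in neighbours -> h x < h y.
    move=> Sy Ny; rewrite ltnNge; apply/negP=> hy.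
    pose D v := [&& v \in S, v \in neighbours & h v < h x].
    have Dy : D y.
      rewrite /D Sy Ny ltn_neqAle hy andbT; apply/eqP=> E.
      by case: (ph x y (setU11 _ _) (setU1r _ Sy)); rewrite ?E //; move: Ny; rewrite inE.
    case: (arg_maxnP h Dy) => m /and3P[Sm Nm hm] max_m.
    suff : m \in top_level (orient h (x |: S)) by rewrite top0 inE.
    apply/(top_levelP _ _ xS); split=> // y' z Sy' Ny' hy' Sz emz hmz.
    by apply: leq_trans (max_m y' _) (ltnW hmz); apply/and3P.
  apply/setP=> -[a b]; rewrite !inE /=.
  case: (eqVneq a x) => [->|nax] /=; rewrite ?(negbTE xS) /=.
    case: (eqVneq b x) => [->|nbx] /=; first by rewrite edge_irr !andbF.
    case Sb: (b \in S) => //=; case exb: (edge x b) => //=.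
    by apply: hx; rewrite ?inE.
  rewrite orbF; case: (eqVneq b x) => [->|] //=; rewrite (negbTE xS) /=.
  case Sa: (a \in S) => //=; case eax: (edge a x) => //=.
  by apply/negbTE; rewrite -leqNgt ltnW // hx // inE edge_sym.
split; first exact: prepend_acyclic.
apply/eqP/setP=> y; rewrite !inE /= (negbTE xS) edge_irr !andbF orbF.
case/acyclicP: So' => h _ ->.
by rewrite !inE /= (negbTE xS) !andbF.
Qed.

Definition representative (L : {set G}) : G := odflt x [pick y in L].

Lemma representative_in L : L != set0 -> representative L \in L.
Proof.
by rewrite /representative; case: pickP => //= L0 /set0Pn[y]; rewrite L0.
Qed.

Lemma top_level_sub S o : x \notin S -> o \in acyclic (x |: S) ->
  top_level o \subset S :&: neighbours.
Proof.
move=> xS /acyclicP[h _ ->]; apply/subsetP=> y /(top_levelP _ _ xS)[Sy Ny _ _].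
exact/setIP.
Qed.

(** The acyclic orientations on [x |: S] are sorted by the top level [L] of the
neighbours that precede [x]. *)
Lemma num_acyclic_insert S : x \notin S ->
  (num_acyclic (x |: S) = num_acyclic S +
    \sum_(L : {set G} | (L \subset S :&: neighbours) && (L != set0))
      num_acyclic (representative L |: S :\: L))%R.
Proof.
move=> xS; rewrite /num_acyclic.
rewrite -(big_morph Posz PoszD (erefl (Posz 0))) -PoszD; congr Posz.
rewrite -sum1_card (partition_big top_level (fun L => L \subset S :&: neighbours)) /=; last first.
  by move=> o; apply: top_level_sub.
have card L : \sum_(o in acyclic (x |: S) | top_level o == L) 1 =
    #|[set o in acyclic (x |: S) | top_level o == L]|.
  by rewrite -sum1_card; apply: eq_bigl => o; rewrite inE.
rewrite (bigD1 set0) ?sub0set //= card card_top_level0 //; congr addn.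
apply: eq_bigr => L /andP[]; rewrite subsetI => /andP[LS LN] L0.
by rewrite card (card_top_level xS (representative_in L0) LS LN).
Qed.

Local Open Scope ring_scope.

(** The right-hand side of [num_acyclic_insert], summed over [S], is regrouped
by [L]; writing [S] as [L :|: S'], the inner sum over [S'] is the one of
[alternating_insert] for the vertex [representative L], up to the term
[alternating _ (U :\: L)]. *)
Lemma alternating_insert_twins U : x \notin U ->
  alternating (@num_acyclic G) (x |: U) =
  \sum_(L : {set G} | (L \subset U :&: neighbours) && (L != set0))
    (alternating (@num_acyclic G) (U :\: L) +
     alternating (@num_acyclic G) (representative L |: U :\: L)).
Proof.
move=> xU; rewrite alternating_insert //.
under eq_bigr => S SU.
  have xS : x \notin S by apply: contra xU; apply: subsetP.
  rewrite num_acyclic_insert // [_ + _ - _]addrC addKr mulr_sumr; over.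
rewrite (exchange_big_dep (fun L : {set G} =>
  (L \subset U :&: neighbours) && (L != set0))) /=; last first.
  move=> S L SU /andP[LS ->]; rewrite andbT.
  exact: subset_trans LS (setSI _ SU).
apply: eq_bigr => L /andP[LU L0].
have LR := representative_in L0.
rewrite alternating_insert; last by rewrite !inE LR.
rewrite /alternating -big_split /=.
rewrite (reindex_onto (fun S => L :|: S) (fun S => S :\: L)) /=; last first.
  move=> S /and3P[_ LS _]; rewrite -{2}(setID S L); congr (_ :|: _).
  by apply/esym/setIidPr; apply: subset_trans LS (subsetIl _ _).
have LsU : L \subset U by apply: subset_trans LU (subsetIl _ _).
have LN : L \subset neighbours by apply: subset_trans LU (subsetIr _ _).
apply: eq_big => [S|S].
  rewrite L0 subsetI subsetUl LN subUset LsU !andbT /= subsetD setDUl setDv set0U.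
  by congr (_ && _); apply/eqP/setDidPl.
case/andP=> _ /eqP ->.
by rewrite mulrBr addrC subrK setDDl.
Qed.

End TwinNeighbours.

(** * Boolean numbers of induced subgraphs *)

Section Embedding.

Variables (G' G : sgraph) (f : G' -> G).
Hypotheses (inj_f : injective f) (edge_f : forall a b, edge (f a) (f b) = edge a b).

Lemma num_acyclic_embed (S : {set G'}) : num_acyclic (f @: S) = num_acyclic S.
Proof.
pose f2 (p : G' * G') := (f p.1, f p.2).
have inj_f2 : injective f2 by move=> [a b] [c d] [/inj_f-> /inj_f->].
congr Posz; rewrite -(card_imset _ (imset_inj inj_f2)); congr #|pred_of_set _|.
have orient_f h : orient h (f @: S) = f2 @: orient (h \o f) S.
  apply/setP=> p; apply/idP/imsetP => [|[[a b]]].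
    rewrite inE => /and4P[/imsetP[a Sa Ea] /imsetP[b Sb Eb] eab hab].
    exists (a, b); last by rewrite /f2 /= -Ea -Eb; case: (p).
    by rewrite inE /= Sa Sb -edge_f -Ea -Eb eab.
  by rewrite inE /= => /and4P[Sa Sb eab hab] ->; rewrite inE /= !imset_f ?edge_f ?eab.
apply/setP=> o; apply/acyclicP/imsetP => [[h ph ->]|[o' /acyclicP[h ph ->] ->]].
  exists (orient (h \o f) S); last exact: orient_f.
  apply/acyclicP; exists (h \o f) => // a b Sa Sb eab.
  by apply: ph; rewrite ?imset_f ?edge_f.
pose h' v := if [pick a | f a == v] is Some a then h a else 0.
have h'f a : h' (f a) = h a.
  rewrite /h'; case: pickP => [b /eqP/inj_f->//|/(_ a)]; by rewrite eqxx.
exists h'.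
  by move=> _ _ /imsetP[a Sa ->] /imsetP[b Sb ->]; rewrite edge_f !h'f; apply: ph.
by rewrite orient_f (@eq_orient _ (h' \o f) h) // => a b _ _ _ /=; rewrite !h'f.
Qed.

Lemma boolean_number_embed :
  ((boolean_number G')%:Z = alternating (@num_acyclic G) (f @: [set: G']))%R.
Proof.
rewrite boolean_numberE /alternating.
rewrite (reindex_onto (fun S : {set G'} => f @: S) (fun S => f @^-1: S)) /=; last first.
  by move=> S /subsetP sub; apply/setP=> y; apply/imsetP/idP => [[a]|Sy];
    [rewrite inE => ? -> | have /imsetP[a _ Ea] := sub y Sy; exists a; rewrite // inE -Ea].
apply: eq_big => [S|S _].
  rewrite subsetT imsetS ?subsetT //; apply/esym/eqP/setP=> a.
  by rewrite inE mem_imset.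
rewrite num_acyclic_embed; congr (_ ^+ _ * _)%R.
have -> : f @: [set: G'] :\: f @: S = f @: ([set: G'] :\: S).
  apply/setP=> y; apply/setDP/imsetP => [[/imsetP[a _ ->] nS]|[a /setDP[_ nS] ->]].
    by exists a; rewrite // !inE andbT; apply: contra nS => /imset_f.
  by rewrite imset_f ?inE // mem_imset.
by rewrite card_imset.
Qed.

End Embedding.

Section Edgeless.

Variables (G : sgraph) (U : {set G}).
Hypothesis edgeless : {in U &, forall a b, edge a b = false}.

Lemma num_acyclic_edgeless (S : {set G}) : S \subset U -> num_acyclic S = 1%R.
Proof.
move=> /subsetP SU; congr Posz; apply/eqP/cards1P; exists set0.
apply/setP=> o; rewrite inE; apply/acyclicP/eqP => [[h _ ->]|->].
  apply/setP=> -[a b]; rewrite !inE /=; apply/negP => /and4P[Sa Sb].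
  by rewrite edgeless ?SU.
exists (fun=> 0); first by move=> a b Sa Sb; rewrite edgeless ?SU.
by apply/setP=> p; rewrite !inE ltnn !andbF.
Qed.

(** For a vertex [v] of [U], the sets [S] and [v |: S] have one orientation
each, and contribute with opposite signs. *)
Lemma alternating_edgeless : alternating (@num_acyclic G) U = Posz (U == set0).
Proof.
case: (set_0Vmem U) => [U0|[v Uv]].
  rewrite /alternating (big_pred1 set0) => [|S]; last by rewrite U0 subset0.
  by rewrite num_acyclic_edgeless ?sub0set // U0 setD0 cards0 eqxx mulr1.
have -> : (U == set0) = false by apply/set0Pn; exists v.
rewrite -(setD1K Uv) alternating_insert ?setD11 // big1 // => S sub.
have SU : S \subset U by apply: subset_trans sub (subsetDl _ _).
rewrite !num_acyclic_edgeless ?subrr ?mulr0 //.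
by rewrite subUset sub1set Uv.
Qed.

End Edgeless.

(** * Binomial sums *)

Lemma sum_subsets_by_card (T : finType) (N : {set T}) (F : nat -> nat) :
  \sum_(L : {set T} | (L \subset N) && (L != set0)) F #|L| =
  \sum_(1 <= l < #|N|.+1) 'C(#|N|, l) * F l.
Proof.
have all_subsets : \sum_(L : {set T} | L \subset N) F #|L| =
    \sum_(0 <= l < #|N|.+1) 'C(#|N|, l) * F l.
  rewrite big_mkord (partition_big (fun L : {set T} => inord #|L| : 'I_#|N|.+1) xpredT) //=.
  apply: eq_bigr => l _; rewrite -cards_draws -sum_nat_const.
  apply: eq_big => [L|L /andP[LN /eqP<-]]; last by rewrite inordK // ltnS subset_leq_card.
  rewrite !inE; case: (boolP (L \subset N)) => //= LN.
  by rewrite -val_eqE /= inordK // ltnS subset_leq_card.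
move: all_subsets; rewrite (bigD1 set0) ?sub0set //= big_ltn // bin0 mul1n cards0.
exact: addnI.
Qed.

(** Shifting the index in the terms [F l.-1] pairs ['C(m, l)] with
['C(m, l.+1)]. *)
Lemma binomial_shift m (F : nat -> nat) :
  \sum_(1 <= l < m.+1) 'C(m, l) * (F l + F l.-1) =
  m * F 0 + \sum_(1 <= l < m.+1) 'C(m.+1, l.+1) * F l.
Proof.
under eq_bigr do rewrite mulnDr; rewrite big_split /=.
have -> : \sum_(1 <= l < m.+1) 'C(m, l) * F l.-1 =
    m * F 0 + \sum_(1 <= l < m.+1) 'C(m, l.+1) * F l.
  transitivity (\sum_(0 <= l < m.+1) 'C(m, l.+1) * F l).
    by rewrite big_add1 /= big_nat_recr //= bin_small // mul0n addn0.
  by rewrite big_ltn // bin1.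
rewrite addnCA -big_split /=; congr (_ + _).
by apply: eq_bigr => l _; rewrite binS mulnDl addnC.
Qed.

(** * Removing the last row of a Ferrers shape *)

Section LastRow.

Variables (la : seq nat).
Hypothesis shape : ferrers_shape la.

Local Notation V := (ferrers_graph la : sgraph).
Local Notation m := (last_row la).

Lemma row_ge i : i < size la -> m <= nth 0 la i.
Proof.
case/andP: shape => la_gt0 la_sorted lti.
rewrite /last_row -nth_last.
have tr : transitive geq by move=> y x z /= xy yz; apply: leq_trans yz xy.
by apply: (sorted_leq_nth tr leqnn 0 la_sorted); rewrite ?inE //= ?prednK // -ltnS prednK.
Qed.

Lemma last_row_lt : (size la).-1 < size la.
Proof. by case/andP: shape => la_gt0 _; rewrite prednK. Qed.

Definition last_vertex : V := inl (Ordinal last_row_lt).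

Lemma last_vertex_neighbours (j : 'I_(head 0 la)) :
  (inr j \in neighbours last_vertex) = (j < m).
Proof. by rewrite inE /= nth_last. Qed.

Lemma last_vertex_nonneighbours (i : 'I_(size la)) :
  (inl i \in neighbours last_vertex) = false.
Proof. by rewrite inE. Qed.

(** Every row is at least as long as the last one, so the columns met by the
last row are adjacent to all rows. *)
Lemma last_vertex_twins :
  {in neighbours last_vertex &, forall y y', @edge V y =1 edge y'}.
Proof.
move=> [i|j] [i'|j']; rewrite ?last_vertex_nonneighbours // !last_vertex_neighbours.
by move=> jm jm' [i|k] //=; rewrite !(leq_trans _ (row_ge _)).
Qed.

Lemma head_ge : m <= head 0 la.
Proof. by rewrite -nth0 row_ge //; case/andP: shape. Qed.

Lemma card_neighbours : #|neighbours last_vertex| = m.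
Proof.
have -> : neighbours last_vertex = inr @: [set j : 'I_(head 0 la) | j < m].
  apply/setP=> -[i|j].
    by rewrite last_vertex_nonneighbours; apply/esym/imsetP=> -[].
  by rewrite last_vertex_neighbours mem_imset ?inE // => ? ? [].
rewrite card_imset; last by move=> ? ? [].
rewrite -sum1_card; under eq_bigl do rewrite inE.
by rewrite (big_ord_narrow head_ge) /= sum1_card card_ord.
Qed.

Section Columns.

Variables (L : {set V}).
Hypothesis LN : L \subset neighbours last_vertex.

Local Notation mu := (shift_down (delete_last_row la) #|L|).

Lemma size_shifted : size mu = (size la).-1.
Proof. by rewrite size_map size_takel // leq_pred. Qed.

Lemma nth_shifted i : i < size mu -> nth 0 mu i = nth 0 la i - #|L|.
Proof.
rewrite size_shifted => lti; rewrite (nth_map 0) ?nth_take // size_takel ?leq_pred //.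
Qed.

Lemma head_shifted : 1 < size la -> head 0 mu = head 0 la - #|L|.
Proof. by move=> la1; rewrite -!nth0 nth_shifted // size_shifted; lia. Qed.

Lemma card_removed : #|L| <= m.
Proof. by rewrite -card_neighbours subset_leq_card. Qed.

(** The columns beyond the end of the last row keep their order, and those of
full height are interchangeable, so it does not matter which of them form [L]. *)
Lemma remove_columns : 1 < size la ->
  exists f : ferrers_graph mu -> V,
    [/\ injective f, forall a b, edge (f a) (f b) = edge a b
      & f @: [set: ferrers_graph mu] = ~: [set last_vertex] :\: L].
Proof.
move=> la1; have lm := card_removed; have mh := head_ge.
have le_size : size mu <= size la by rewrite size_shifted leq_pred.
have le_head : head 0 mu <= head 0 la by rewrite head_shifted ?leq_subr.
pose K : {set 'I_(head 0 la)} := [set j : 'I_(head 0 la) | (j < m) && ((inr j : V) \notin L)].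
have cardK : #|K| = m - #|L|.
  have inr_inj : injective (inr : 'I_(head 0 la) -> V) by move=> ? ? [].
  rewrite -card_neighbours -(card_imset _ inr_inj) -(setIidPr LN) -cardsD.
  congr #|pred_of_set _|; apply/setP=> -[i|j]; rewrite in_setD.
    by rewrite last_vertex_nonneighbours andbF; apply/imsetP=> -[].
  by rewrite mem_imset // inE last_vertex_neighbours andbC.
(* The first columns go to the remaining full ones, in any order; the others
   move by [#|L|]. Neither default value is ever reached. *)
pose col (j : 'I_(head 0 mu)) : 'I_(head 0 la) :=
  let j0 := widen_ord le_head j in
  if j < m - #|L| then nth j0 (enum K) j else insubd j0 (j + #|L|).
have col_small (j : 'I_(head 0 mu)) : j < m - #|L| -> col j \in K.
  move=> ltj; rewrite /col ltj -mem_enum mem_nth // -cardE cardK //.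
have col_big (j : 'I_(head 0 mu)) : m - #|L| <= j -> col j = j + #|L| :> nat.
  move=> lej; rewrite /col ltnNge lej /= val_insubd.
  suff -> : j + #|L| < head 0 la by [].
  by rewrite addnC -ltn_subRL -head_shifted.
have col_inj : injective col.
  move=> j j' Ej; apply: val_inj => /=.
  case: (ltnP j (m - #|L|)) => hj; case: (ltnP j' (m - #|L|)) => hj'.
  - move: Ej; rewrite /col hj hj' (set_nth_default (widen_ord le_head j)) -?cardE ?cardK // => /eqP.
    by rewrite nth_uniq ?enum_uniq -?cardE ?cardK // => /eqP.
  - have := col_small _ hj; rewrite Ej inE => /andP[]; rewrite col_big //; lia.
  - have := col_small _ hj'; rewrite -Ej inE => /andP[]; rewrite col_big //; lia.
  - by move/(congr1 val): Ej; rewrite /= !col_big // => /addIn.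
pose f (v : ferrers_graph mu) : V :=
  match v with inl i => inl (widen_ord le_size i) | inr j => inr (col j) end.
have inj_f : injective f.
  move=> [i|j] [i'|j'] // []; first by move=> E; congr inl; apply: val_inj.
  by move/col_inj->.
have edge_ij (i : 'I_(size mu)) j : (col j < nth 0 la i) = (j < nth 0 mu i).
  have row_i : m <= nth 0 la i by exact: row_ge (leq_trans (ltn_ord i) le_size).
  rewrite nth_shifted //; case: (ltnP j (m - #|L|)) => hj; last by rewrite col_big //; lia.
  by have := col_small _ hj; rewrite inE => /andP[hc _]; lia.
exists f; split=> //; first by move=> [i|j] [i'|j'] /=; rewrite ?edge_ij.
apply/eqP; rewrite eqEcard; apply/andP; split.
  apply/subsetP=> _ /imsetP[[i|j] _ ->]; rewrite !inE /=.
    rewrite (contraFN (subsetP LN _)) ?last_vertex_nonneighbours //=.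
    apply/eqP=> -[]/= E; have := ltn_ord i; rewrite {2}size_shifted E ltnn //.
  case: (ltnP j (m - #|L|)) => hj.
    by have := col_small _ hj; rewrite inE => /andP[_ ->].
  rewrite andbT; apply/negP => /(subsetP LN); rewrite last_vertex_neighbours col_big //; lia.
rewrite card_imset // cardsT card_sum !card_ord size_shifted head_shifted //.
have -> : ~: [set last_vertex] :\: L = ~: (last_vertex |: L) by rewrite setCU setDE.
rewrite cardsCs setCK cardsU1 card_sum !card_ord.
have -> : last_vertex \notin L.
  by apply: contraFN (subsetP LN _) (last_vertex_nonneighbours _).
by lia.
Qed.

Lemma alternating_remove_columns : 1 < size la ->
  alternating (@num_acyclic V) (~: [set last_vertex] :\: L) = Posz (beta mu).
Proof.
move=> la1; have [f [inj_f edge_f <-]] := remove_columns la1.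
by rewrite /beta (boolean_number_embed inj_f edge_f).
Qed.

End Columns.

Lemma beta_sum_columns :
  Posz (beta la) =
  (\sum_(L : {set V} | (L \subset neighbours last_vertex) && (L != set0))
    (alternating (@num_acyclic V) (~: [set last_vertex] :\: L) +
     alternating (@num_acyclic V)
       (representative last_vertex L |: ~: [set last_vertex] :\: L)))%R.
Proof.
have -> : Posz (beta la) = alternating (@num_acyclic V) (last_vertex |: ~: [set last_vertex]).
  by rewrite /beta boolean_numberE; congr alternating; rewrite setUCr.
rewrite (alternating_insert_twins last_vertex_twins); last by rewrite !inE eqxx.
apply: eq_bigl => L; congr (_ && _).
rewrite (setIidPr _) //; apply/subsetP=> v Nv; rewrite !inE.
by apply: contraTneq Nv => ->; rewrite last_vertex_nonneighbours.
Qed.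

(** All sets involved are edgeless, so [alternating_edgeless] leaves only the
set [L] of all columns; it is excluded as a summand when it is empty. *)
Lemma beta_single_row : size la = 1 -> beta la = (0 < m).
Proof.
move=> la1; apply/eqP; rewrite -eqz_nat; apply/eqP; rewrite beta_sum_columns.
set U := ~: [set last_vertex].
have UN : U = neighbours last_vertex.
  apply/setP=> -[i|j].
    rewrite last_vertex_nonneighbours !inE; apply/negbTE; rewrite negbK.
    apply/eqP; congr inl; apply: val_inj => /=.
    by have lti := ltn_ord i; lia.
  rewrite last_vertex_neighbours !inE; apply/esym/(leq_trans (ltn_ord j)).
  by rewrite /last_row -nth_last la1 nth0.
have edgeless : {in U &, forall a b, @edge V a b = false}.
  by rewrite UN; apply: neighbours_independent last_vertex_twins.
have sub_edgeless (U' : {set V}) : U' \subset U ->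
    alternating (@num_acyclic V) U' = Posz (U' == set0).
  move=> /subsetP sub; apply: alternating_edgeless => a b Ua Ub.
  by apply: edgeless; apply: sub.
transitivity (\sum_(L : {set V} | (L \subset U) && (L != set0)) Posz (L == U))%R.
  rewrite -UN; apply: eq_bigr => L /andP[LU L0].
  have rU := subsetP LU _ (representative_in last_vertex L0).
  rewrite !sub_edgeless ?subsetDl //; last by rewrite subUset sub1set rU subsetDl.
  have -> : (representative last_vertex L |: U :\: L == set0) = false.
    by apply/negbTE/set0Pn; exists (representative last_vertex L); rewrite setU11.
  by rewrite addr0 setD_eq0 eqEsubset LU.
rewrite -(card_neighbours) -UN lt0n cards_eq0.
case: (eqVneq U set0) => [U0|nU].
  by rewrite big_pred0 // => L; rewrite U0 subset0 andbN.
rewrite (bigD1 U) ?subxx //= eqxx big1 // => L /andP[_ /negbTE->] //.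
Qed.

(** If [r] represents [L], putting [r] back amounts to removing the columns of
[L :\ r] only; hence the shapes [mu[-l]] and [mu[-(l - 1)]] for [l = #|L|]. *)
Lemma beta_last_row : 1 < size la ->
  beta la = m * beta (delete_last_row la)
    + \sum_(1 <= l < m.+1) 'C(m.+1, l.+1) * beta (shift_down (delete_last_row la) l).
Proof.
move=> la1; apply/eqP; rewrite -eqz_nat; apply/eqP; rewrite beta_sum_columns.
pose b l := beta (shift_down (delete_last_row la) l).
have b0 : b 0 = beta (delete_last_row la).
  by rewrite /b /shift_down; under eq_map do rewrite subn0; rewrite map_id.
transitivity (\sum_(L : {set V} | (L \subset neighbours last_vertex) && (L != set0))
    Posz (b #|L| + b #|L|.-1))%R.
  apply: eq_bigr => L /andP[LN L0]; rewrite PoszD alternating_remove_columns //.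
  congr (_ + _)%R; have rL := representative_in last_vertex L0.
  set r := representative _ _ in rL *.
  have -> : r |: ~: [set last_vertex] :\: L = ~: [set last_vertex] :\: (L :\ r).
    apply/setP=> v; rewrite !inE; case: (eqVneq v r) => [->|] //=.
    by apply/esym; apply: contraTneq (subsetP LN _ rL) => ->; rewrite last_vertex_nonneighbours.
  rewrite alternating_remove_columns ?(subset_trans (subsetDl _ _)) //.
  by rewrite /b [in RHS](cardsD1 r) rL.
rewrite -(big_morph Posz PoszD (erefl (Posz 0))); congr Posz.
rewrite (sum_subsets_by_card _ (fun l => b l + b l.-1)) card_neighbours.
by rewrite binomial_shift b0.
Qed.

End LastRow.

(* The one-row shape (0) is set apart: its graph is a single isolated vertex,
   whose boolean number is 0, not 1. *)
Theorem theorem3p4 (la : seq nat) (hla : ferrers_shape la) :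
  beta la =
    if size la == 1 then (if la == [:: 0] then 0 else 1)
    else last_row la * beta (delete_last_row la)
         + \sum_(1 <= l < (last_row la).+1)
             'C((last_row la).+1, l.+1)
               * beta (shift_down (delete_last_row la) l).
Proof.
case: eqP => [la1|/eqP la1].
  rewrite beta_single_row //; case: la la1 {hla} => [|k []] //= _.
  by rewrite /last_row /=; case: k.
by apply: beta_last_row => //; case/andP: hla => la_gt0 _; rewrite ltn_neqAle eq_sym la1.
Qed.
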